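(* Let $I$ be a nonzero proper ideal of $R$. Then the following inequalities hold: (1) $a(I)\le (r-1)\,l_R\big(R/(I^{**}+\theta_D)\big)-l_R(I^{**}/I)$ and $a(I)\ge r-1-l_R(I^{**}/I)-d(I)$; (2) $b(I)\le (r-1)\big(l_R(R/I)-1\big)+l_R(I^{**}/I)+d(I)$ and $b(I)\ge (r-1)\,l_R\big((I^{**}+\theta_D)/I\big)+l_R(I^{**}/I)$.
   Context: Setting: $(R,\mathfrak m)$ is a one-dimensional Noetherian local domain with infinite residue field $k$ and fraction field $K$. Its integral closure $\overline R$ in $K$ is a finite $R$-module and a discrete valuation ring with uniformizer $t$ (analytically irreducible), and $R$ is residually rational: the natural map $k\to\overline R/t\overline R$ is an isomorphism. $v:K\to\mathbb Z\cup\{\infty\}$ is the valuation of $\overline R$ with $v(t)=1$; for a subset $J\subseteq K$, $v(J)=\{v(a): 0\ne a\in J\}$. $l_R$ denotes length of $R$-modules. For fractional ideals, $I:J=\{x\in K: xJ\subseteq I\}$, $I^*=R:I$, $I^{**}=(I^* )^*$. Put $\gamma=R:\overline R=t^c\overline R$ with $c=l_R(\overline R/\gamma)$, $\delta=l_R(\overline R/R)$, $n=c-\delta=l_R(R/\gamma)$, $r=l_R((R:\mathfrak m)/R)$. $\omega$ is a canonical module of $R$ chosen as a fractional ideal with $R\subseteq\omega\subseteq\overline R$ (so $\omega:(\omega:J)=J$ for all nonzero fractional ideals $J$), and $\theta_D=\omega^*=R:\omega$ is the Dedekind different. Type sequence: let $s_0=0<s_1<\dots<s_n=c<s_{n+1}=c+1<\dots$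 be the elements of $v(R)$, $R_i=\{a\in R: v(a)\ge s_i\}$, and for $i\ge1$ let $r_i=l_R\big((R:R_i)/(R:R_{i-1})\big)$. One has $r_1=r$, and $r_i=1$ for $i>n$. For a nonzero proper ideal $I$ of $R$: $\gamma_I=t^{c_I}\overline R$ is the largest $\overline R$-ideal contained in $I$; $n_I=l_R(R/\gamma_I)=c_I-\delta$; $V^I=\{h+1: h\ge0,\ s_h\in v(I^{**})\}$; $d(I)=l_R\big((R:\gamma_I)/I^*\big)-\sum_{h\le n_I,\,h\in V^I}r_h$; $a(I)=l_R(I^*/R)-l_R(R/I)$; $b(I)=r\,l_R(R/I)-l_R(I^*/R)$. *)

(* Defs.v *)
From HB Require Import structures.
From mathcomp Require Import all_boot all_order all_algebra.
From mathcomp Require Import all_classical.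
From mathcomp Require Import constructive_ereal.

Set Implicit Arguments.
Unset Strict Implicit.
Unset Printing Implicit Defensive.

Import Order.TTheory GRing.Theory Num.Theory.

Local Open Scope classical_set_scope.
Local Open Scope ring_scope.

Definition is_ideal (R : idomainType) (I : set R) : Prop :=
  [/\ I 0, forall x y, I x -> I y -> I (x + y) & forall a x, I x -> I (a * x)].

Definition noetherian (R : idomainType) : Prop :=
  forall I : set R, is_ideal I -> exists (n : nat) (g : 'I_n -> R),
    I = range (fun a : 'I_n -> R => \sum_(i < n) a i * g i).

Definition prime_ideal (R : idomainType) (P : set R) : Prop :=
  [/\ is_ideal P, P <> setT & forall x y, P (x * y) -> P x \/ P y].

Definition maximal_ideal (R : idomainType) (M : set R) : Prop :=
  [/\ is_ideal M, M <> setT &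
      forall J, is_ideal J -> M `<=` J -> J <> setT -> J = M].

Definition local_ring (R : idomainType) (m : set R) : Prop :=
  maximal_ideal m /\ forall m' : set R, maximal_ideal m' -> m' = m.

Definition prime_chain (R : idomainType) (l : nat) : Prop :=
  exists C : nat -> set R, (forall i, (i <= l)%N -> prime_ideal (C i)) /\
    (forall i, (i < l)%N -> C i `<` C i.+1).

Definition krull_dim (R : idomainType) (d : nat) : Prop :=
  prime_chain R d /\ forall l, prime_chain R l -> (l <= d)%N.

Definition infinite_residue_field (R : idomainType) (m : set R) : Prop :=
  infinite_set (range (fun x : R => [set y | m (y - x)])).

(* Below, K = {fraction R}, R is identified with its image [Rk R] in K, and
   Rbar is [int_closure R]. *)

Definition emb (R : idomainType) (I : set R) : set {fraction R} :=
  @tofrac R @` I.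

Definition Rk (R : idomainType) : set {fraction R} := emb [set: R].
Arguments Rk R : clear implicits.

Definition int_closure (R : idomainType) : set {fraction R} :=
  [set x | integralOver (@tofrac R) x].
Arguments int_closure R : clear implicits.

Definition submod (R : idomainType) (J : set {fraction R}) : Prop :=
  [/\ J 0, forall x y, J x -> J y -> J (x + y) &
      forall (a : R) x, J x -> J (tofrac a * x)].

Definition fin_gen (R : idomainType) (J : set {fraction R}) : Prop :=
  exists (n : nat) (g : 'I_n -> {fraction R}),
    J = range (fun a : 'I_n -> R => \sum_(i < n) tofrac (a i) * g i).

Definition fractional_ideal (R : idomainType) (J : set {fraction R}) : Prop :=
  submod J /\
  exists d : R, d != 0 /\ forall x, J x -> Rk R (tofrac d * x).

Definition colon (R : idomainType) (I J : set {fraction R}) :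
    set {fraction R} :=
  [set x | forall y, J y -> I (x * y)].

Definition star (R : idomainType) (J : set {fraction R}) : set {fraction R} :=
  colon (Rk R) J.

Definition addS (R : idomainType) (A B : set {fraction R}) :
    set {fraction R} :=
  [set z | exists x y, [/\ A x, B y & z = x + y]].

(* A chain of submodules of length l from N up to M; by the correspondence
   theorem these are the chains of submodules of M / N. *)
Definition submod_chain (R : idomainType) (M N : set {fraction R})
    (l : nat) : Prop :=
  exists C : nat -> set {fraction R},
    [/\ C 0%N = N, C l = M, forall i, (i <= l)%N -> submod (C i) &
        forall i, (i < l)%N -> C i `<` C i.+1].

(* [len M N] is l_R(M / N) for submodules N <= M of K: the largest length of a
   chain of submodules.  The value is the junk 0 if the length is infinite. *)
Definition len (R : idomainType) (M N : set {fraction R}) : nat :=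
  xget 0%N [set l | submod_chain M N l /\
                    forall l', submod_chain M N l' -> (l' <= l)%N].

(* Valuations K -> Z u {oo}. *)
Definition is_valuation (K : fieldType) (v : K -> \bar int) : Prop :=
  [/\ forall x, v x <> -oo%E,
      forall x, v x = +oo%E <-> x = 0,
      forall x y, (v (x * y)%R = v x + v y)%E &
      forall x y, (Order.min (v x) (v y) <= v (x + y)%R)%E].

(* [B] is a discrete valuation ring with uniformizer [t] and valuation [v]. *)
Definition is_dvr (K : fieldType) (B : set K) (t : K) (v : K -> \bar int) :
    Prop :=
  [/\ is_valuation v, B = [set x | (0 <= v x)%E] & v t = 1%E].

(* The natural map R / m -> Rbar / t Rbar is well defined and injective (first
   clause) and surjective (second clause). *)
Definition residually_rational (R : idomainType) (m : set R)
    (t : {fraction R}) : Prop :=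
  (forall a : R, m a <->
     exists2 y, int_closure R y & tofrac a = t * y) /\
  (forall x, int_closure R x -> exists a : R,
     exists2 y, int_closure R y & x - tofrac a = t * y).

Definition vset (K : fieldType) (v : K -> \bar int) (J : set K) : set int :=
  [set z | exists a, [/\ J a, a <> 0 & v a = z%:E]].

Definition value_enum (R : idomainType) (v : {fraction R} -> \bar int)
    (s : nat -> int) : Prop :=
  (forall i j, (i < j)%N -> s i < s j) /\ range s = vset v (Rk R).

(* Canonical fractional ideals, in the sense of Herzog and Kunz: nonzero
   fractional ideals dualizing all nonzero fractional ideals. *)
Definition canonical_ideal (R : idomainType) (w : set {fraction R}) : Prop :=
  [/\ fractional_ideal w, w <> [set 0] &
      forall J : set {fraction R}, fractional_ideal J -> J <> [set 0] ->
        colon w (colon w J) = J].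

Definition different (R : idomainType) (w : set {fraction R}) :
    set {fraction R} :=
  star w.

Definition cm_type (R : idomainType) (m : set R) : nat :=
  len (colon (Rk R) (emb m)) (Rk R).

Definition R_ (R : idomainType) (v : {fraction R} -> \bar int)
    (s : nat -> int) (i : nat) : set {fraction R} :=
  [set a | Rk R a /\ ((s i)%:E <= v a)%E].

(* The type sequence r_i, meaningful for i >= 1. *)
Definition type_seq (R : idomainType) (v : {fraction R} -> \bar int)
    (s : nat -> int) (i : nat) : nat :=
  len (colon (Rk R) (R_ v s i)) (colon (Rk R) (R_ v s i.-1)).

Definition int_closure_ideal (R : idomainType) (L : set {fraction R}) : Prop :=
  [/\ L 0, forall x y, L x -> L y -> L (x + y),
      forall b x, int_closure R b -> L x -> L (b * x) &
      L `<=` int_closure R].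

(* The largest Rbar-ideal contained in I, as the union of all of them. *)
Definition gamma (R : idomainType) (I : set R) : set {fraction R} :=
  [set x | exists L, [/\ int_closure_ideal L, L `<=` emb I & L x]].

Definition n_ (R : idomainType) (I : set R) : nat := len (Rk R) (gamma I).

Definition V_ (R : idomainType) (v : {fraction R} -> \bar int)
    (s : nat -> int) (I : set R) : set nat :=
  [set k | exists2 h : nat, vset v (star (star (emb I))) (s h) & k = h.+1].

Definition d_ (R : idomainType) (v : {fraction R} -> \bar int)
    (s : nat -> int) (I : set R) : int :=
  (len (colon (Rk R) (gamma I)) (star (emb I)))%:Z -
  (\sum_(h < (n_ I).+1 | (h : nat) \in V_ v s I) type_seq v s h)%N%:Z.

Definition a_ (R : idomainType) (I : set R) : int :=
  (len (star (emb I)) (Rk R))%:Z - (len (Rk R) (emb I))%:Z.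

Definition b_ (R : idomainType) (m I : set R) : int :=
  (cm_type m)%:Z * (len (Rk R) (emb I))%:Z - (len (star (emb I)) (Rk R))%:Z.

(* Main.v *)
From mathcomp Require Import zify ring.
Require Import Defs.
From mathcomp Require Import all_boot all_order all_algebra.
From mathcomp Require Import all_classical.
From mathcomp Require Import constructive_ereal.

Set Implicit Arguments.
Unset Strict Implicit.
Unset Printing Implicit Defensive.

Import Order.TTheory GRing.Theory Num.Theory.

Local Open Scope classical_set_scope.
Local Open Scope ring_scope.

(** The second pair of inequalities follows from the first: by additivity of
    length [b_ m I = (r - 1) l(R / I) - a_ I], and [I2 + theta] and [I2] both
    lie between [I1] and [R]. So everything reduces to bounding [l(I^* / R)],
    where [I^*] is also the dual of the bidual [J = I2].

    Two tools measure lengths. First, residual rationality makes a strict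
    inclusion of lattices (submodules squeezed between two powers of the
    maximal ideal of the valuation ring) visible on values, so that
    [l(M / N)] is the number of values of [M] that are not values of [N]
    ([len_values]); additivity and finiteness of length follow ([lenD]).
    Second, [w : _] reverses chains of lattices, hence preserves lengths
    ([len_dual]), and [R : J = w : (w J)] ([starE]).

    Upper bound ([len_star_upper]): by duality [l(J^* / R) = l(w / w J)].
    Split this at [R + w J]. The lower part is a quotient of [R / J]. The upper
    part [w / (R + w J)] is killed by [J] and by [theta], since
    [theta w <= R]; and since [1] is part of a minimal system of generators of
    [w], which has [r] elements because [l(w / m w) = l((R : m) / R)], it is
    generated by [r - 1] elements, so its length is at most
    [(r - 1) l(R / (J + theta))] ([len_gens_bound]).

    Lower bound ([len_star_lower]): [gamma_I] is one of the ideals [R_i], with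
    [i = n_I], so [l((R : gamma_I) / R)] is the sum of [r_1], ..., [r_(n_I)].
    Subtracting [l((R : gamma_I) / I^* )] leaves the sum of the [r_i] with
    [i] outside [V_ I], minus [d_ I]. The indices outside [V_ I] are
    [l(R / J)] many, every [r_i] is positive because [w R_(i - 1)] contains
    strictly [w R_i] ([type_seq_gt0]), and the index [1], with [r_1 = r], is
    one of them because [J] is a proper ideal ([star2_no_unit]). *)

(** * Submodules of the fraction field and chains *)

Section Submodules.
Variable R : idomainType.
Local Notation K := {fraction R}.
Implicit Types (A B C J M N P : set K).

Lemma submodB J x y : submod J -> J x -> J y -> J (x - y).
Proof.
case=> _ JD JZ Jx Jy; apply: JD => //.
by have := JZ (-1) y Jy; rewrite rmorphN1 mulN1r.
Qed.

Lemma Rk_submod : submod (Rk R).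
Proof.
split; first by exists 0; rewrite ?rmorph0.
- by move=> _ _ [x _ <-] [y _ <-]; exists (x + y); rewrite ?rmorphD.
- by move=> a _ [x _ <-]; exists (a * x); rewrite ?rmorphM.
Qed.

Lemma Rk1 : Rk R 1.
Proof. by exists 1; rewrite ?rmorph1. Qed.

Lemma Rk_mul x y : Rk R x -> Rk R y -> Rk R (x * y).
Proof. by case=> a _ <-; have [_ _ +] := Rk_submod; apply. Qed.

Lemma submodZ J x y : submod J -> Rk R x -> J y -> J (x * y).
Proof. by case=> _ _ JZ [a _ <-]; apply: JZ. Qed.

Lemma frac_den (x : K) : exists2 d : R, d != 0 & Rk R (tofrac d * x).
Proof.
elim/quotW: x => x; exists (frac x).2; first exact: denom_ratioP.
exists (frac x).1 => //; unlock tofrac; rewrite -[RHS]FracField.pi_mul.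
apply/eqmodP; rewrite /= FracField.equivfE /FracField.mulf.
by rewrite !numden_Ratio ?mulf_neq0 ?oner_neq0 ?denom_ratioP// !mul1r mulrC.
Qed.

Lemma emb_submod (I : set R) : is_ideal I -> submod (emb I).
Proof.
case=> I0 ID IZ; split; first by exists 0; rewrite ?rmorph0.
- by move=> _ _ [x Ix <-] [y Iy <-]; exists (x + y); rewrite ?rmorphD//; exact: ID.
- by move=> a _ [x Ix <-]; exists (a * x); rewrite ?rmorphM//; exact: IZ.
Qed.

Lemma emb_sub_Rk (I : set R) : emb I `<=` Rk R.
Proof. by move=> _ [x _ <-]; exists x. Qed.

Lemma submodI A B : submod A -> submod B -> submod (A `&` B).
Proof.
move=> [A0 AD AZ] [B0 BD BZ]; split=> //.
- by move=> x y [? ?] [? ?]; split; [exact: AD|exact: BD].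
- by move=> a x [? ?]; split; [exact: AZ|exact: BZ].
Qed.

Lemma addS_submod A B : submod A -> submod B -> submod (addS A B).
Proof.
move=> [A0 AD AZ] [B0 BD BZ]; split.
- by exists 0, 0; rewrite addr0.
- move=> _ _ [x [y [Ax By ->]]] [x' [y' [Ax' By' ->]]].
  by exists (x + x'), (y + y'); split; [exact: AD|exact: BD|rewrite addrACA].
- move=> a _ [x [y [Ax By ->]]]; exists (tofrac a * x), (tofrac a * y).
  by split; [exact: AZ|exact: BZ|rewrite mulrDr].
Qed.

Lemma addSl A B : submod B -> A `<=` addS A B.
Proof. by case=> B0 _ _ x Ax; exists x, 0; rewrite addr0. Qed.

Lemma addSr A B : submod A -> B `<=` addS A B.
Proof. by case=> A0 _ _ x Bx; exists 0, x; rewrite add0r. Qed.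

Lemma addS_min A B J : submod J -> A `<=` J -> B `<=` J -> addS A B `<=` J.
Proof.
by move=> [_ JD _] AJ BJ _ [x [y [/AJ Jx /BJ Jy ->]]]; exact: JD.
Qed.

Lemma colon_submod A B : submod A -> submod (colon A B).
Proof.
move=> [A0 AD AZ]; split; first by move=> y _; rewrite mul0r.
- by move=> x x' Ax Ax' y By; rewrite mulrDl; apply: AD; [exact: Ax|exact: Ax'].
- by move=> a x Ax y By; rewrite -mulrA; apply: AZ; exact: Ax.
Qed.

Lemma colonS A B B' : B `<=` B' -> colon A B' `<=` colon A B.
Proof. by move=> BB' x Ax y /BB'; exact: Ax. Qed.

Lemma colon1 A : submod A -> colon A (Rk R) = A.
Proof.
move=> sA; apply/seteqP; split=> x.
  by move=> /(_ 1 Rk1); rewrite mulr1.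
by move=> Ax y Ry; rewrite mulrC; exact: submodZ.
Qed.

Definition scal (x : K) A : set K := [set x * y | y in A].

Lemma scal_submod x A : submod A -> submod (scal x A).
Proof.
move=> [A0 AD AZ]; split; first by exists 0; rewrite ?mulr0.
- move=> _ _ [y Ay <-] [z Az <-]; exists (y + z); rewrite ?mulrDr//.
  exact: AD.
- by move=> a _ [y Ay <-]; exists (tofrac a * y); [exact: AZ|rewrite mulrCA].
Qed.

Lemma preim_submod x P : submod P -> submod [set y | P (x * y)].
Proof.
move=> [P0 PD PZ]; split=> [|y z /= ? ?|a y /= ?] /=.
- by rewrite mulr0.
- by rewrite mulrDr; exact: PD.
- by rewrite mulrCA; exact: PZ.
Qed.

(** The product of two submodules is encoded as the intersection of all
    submodules that contain the products, so that inclusions of a product are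
    checked on products of elements. *)
Definition mulS A B : set K :=
  [set x | forall P, submod P -> (forall a b, A a -> B b -> P (a * b)) -> P x].

Lemma mulS_submod A B : submod (mulS A B).
Proof.
split; first by move=> P [].
- by move=> x y Ax Ay P sP PAB; case: (sP) => _ PD _; apply: PD;
    [exact: Ax|exact: Ay].
- by move=> a x Ax P sP PAB; case: (sP) => _ _ PZ; apply: PZ; exact: Ax.
Qed.

Lemma mulS_mul A B a b : A a -> B b -> mulS A B (a * b).
Proof. by move=> Aa Bb P _; apply. Qed.

Lemma mulS_min A B P : submod P -> (forall a b, A a -> B b -> P (a * b)) ->
  mulS A B `<=` P.
Proof. by move=> sP PAB x; exact. Qed.

Lemma colon_mulS A B C : submod A ->
  colon A (mulS B C) = colon (colon A B) C.
Proof.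
move=> sA; apply/seteqP; split=> x Ax.
  by move=> c Cc b Bb; rewrite -mulrA (mulrC c); apply: Ax; exact: mulS_mul.
move=> y /(_ _ (preim_submod x sA)); apply=> b c Bb Cc /=.
by rewrite (mulrC b) mulrA; exact: Ax.
Qed.

Lemma chain_cons M N N' l : submod N -> N `<` N' ->
  submod_chain M N' l -> submod_chain M N l.+1.
Proof.
move=> sN NN' [C [C0 Cl sC ltC]].
exists (fun i => if i is j.+1 then C j else N); split=> //.
- by case=> // i /sC.
- by case=> [_|i /ltC//]; rewrite C0.
Qed.

Lemma chain_mono (C : nat -> set K) l i j :
  (forall i, (i < l)%N -> C i `<` C i.+1) -> (i <= j <= l)%N -> C i `<=` C j.
Proof.
move=> ltC; elim: j => [|j IHj].
  by case/andP; rewrite leqn0 => /eqP-> _ x.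
move=> /andP[]; rewrite leq_eqVlt => /predU1P[-> _ x //|ij] jl.
apply: subset_trans (IHj _) _; first by rewrite -ltnS ij ltnW.
by have [] := ltC j jl.
Qed.

Lemma chain_sub M N l : submod_chain M N l -> N `<=` M.
Proof.
by case=> C [<- <- _ ltC]; apply: chain_mono ltC _; rewrite leqnn.
Qed.

Lemma len_eq M N l : submod_chain M N l ->
  (forall l', submod_chain M N l' -> (l' <= l)%N) -> len M N = l.
Proof.
move=> cl ml; apply: xget_unique => // l' [cl' ml'].
by apply/eqP; rewrite eqn_leq ml// ml'.
Qed.

End Submodules.

(** * Lengths of lattices as numbers of values *)

Section Values.
Variables (R : idomainType) (m : set R) (t : {fraction R}).
Variable v : {fraction R} -> \bar int.
Hypothesis Rbar_finite : fin_gen (int_closure R).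
Hypothesis Rbar_dvr : is_dvr (int_closure R) t v.
Hypothesis R_resrat : residually_rational m t.
Local Notation K := {fraction R}.
Implicit Types (A B C J M N P : set K) (x y : K) (z n e b : int).

Definition vge n : set K := [set x | (n%:E <= v x)%E].

Lemma val_fin x : x != 0 -> exists z, v x = z%:E.
Proof.
move=> x0; have [[vN vy _ _] _ _] := Rbar_dvr.
case E: (v x) => [z| |]; first by exists z.
- by move/vy: E => /eqP; rewrite (negPf x0).
- by move: (vN x).
Qed.

Lemma val0 : v 0 = +oo%E.
Proof. by have [[_ vy _ _] _ _] := Rbar_dvr; apply/vy. Qed.

Lemma val_neq0 x z : v x = z%:E -> x != 0.
Proof. by move=> vx; apply/eqP => x0; move: vx; rewrite x0 val0. Qed.

Lemma valM x y : v (x * y) = (v x + v y)%E.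
Proof. by have [[]] := Rbar_dvr. Qed.

Lemma val1 : v 1 = 0%:E.
Proof.
have [z vz] := val_fin (oner_neq0 K).
have := valM 1 1; rewrite mulr1 vz -EFinD => -[] zz.
by congr EFin; lia.
Qed.

Lemma valV x z : v x = z%:E -> v x^-1 = (- z)%:E.
Proof.
move=> vx; have x0 := val_neq0 vx.
have [u vu] : exists u, v x^-1 = u%:E by apply: val_fin; rewrite invr_eq0.
have := valM x x^-1; rewrite mulfV// val1 vx vu -EFinD => -[] E.
by congr EFin; lia.
Qed.

Lemma val_surj z : exists x, v x = z%:E.
Proof.
have [_ _ vt] := Rbar_dvr.
have vtn (k : nat) : v (t ^+ k) = k%:Z%:E.
  elim: k => [|k IHk]; first exact: val1.
  by rewrite exprS valM IHk vt -EFinD; congr EFin; lia.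
case: z => k; first by exists (t ^+ k).
by exists (t ^+ k.+1)^-1; rewrite (valV (vtn _)) NegzE.
Qed.

Lemma vgeE n x z : v x = z%:E -> vge n x <-> n <= z.
Proof. by rewrite /vge /= => ->; rewrite lee_fin. Qed.

Lemma vge_0 n : vge n 0.
Proof. by rewrite /vge /= val0 leey. Qed.

Lemma vgeD n x y : vge n x -> vge n y -> vge n (x + y).
Proof.
have [[_ _ _ vD] _ _] := Rbar_dvr; rewrite /vge /= => nx ny.
by apply: le_trans (vD x y); rewrite le_min nx.
Qed.

Lemma vgeM a b x y : vge a x -> vge b y -> vge (a + b) (x * y).
Proof. by rewrite /vge /= valM EFinD => ? ?; exact: leeD. Qed.

Lemma vgeW n n' : n <= n' -> vge n' `<=` vge n.
Proof. by move=> nn' x; rewrite /vge /=; apply: le_trans; rewrite lee_fin. Qed.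

Lemma vge_bar : int_closure R = vge 0.
Proof. by have [_ -> _] := Rbar_dvr. Qed.

Lemma Rk_vge0 : Rk R `<=` vge 0.
Proof. by rewrite -vge_bar => _ [x _ <-]; exact: integral_id. Qed.

Lemma vge_submod n : submod (vge n).
Proof.
split; [exact: vge_0|exact: vgeD|move=> a x nx].
by rewrite -[n]add0r; apply: vgeM => //; apply: Rk_vge0; exists a.
Qed.

Lemma vge_divr n x y z : v x = z%:E -> vge n y -> vge (n - z) (y / x).
Proof. by move=> vx ny; apply: vgeM => //; apply/(vgeE _ (valV vx)). Qed.

Lemma vge_next n x : vge n x -> ~ vge (n + 1) x -> v x = n%:E.
Proof.
have [->|x0] := eqVneq x 0; first by move=> _ []; exact: vge_0.
have [z vz] := val_fin x0; rewrite !(vgeE _ vz) vz => ? ?.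
by congr EFin; lia.
Qed.

Lemma val_addl x y z : v x = z%:E -> vge (z + 1) y -> v (x + y) = z%:E.
Proof.
move=> vx zy; apply: vge_next.
  by apply: vgeD; [apply/(vgeE _ vx)|apply: vgeW zy; lia].
move=> zxy; have : vge (z + 1) x.
  have -> : x = (x + y) - y by rewrite addrK.
  exact: submodB (vge_submod _) zxy zy.
by rewrite (vgeE _ vx); lia.
Qed.

Lemma vsetP J z : vset v J z <-> exists2 a, J a & v a = z%:E.
Proof.
split=> [[a [Ja _ va]]|[a Ja va]]; first by exists a.
by exists a; split=> //; apply/eqP/(val_neq0 va).
Qed.

Lemma m_vge a : m a <-> vge 1 (tofrac a).
Proof.
have [_ _ vt] := Rbar_dvr; have [-> _] := R_resrat; rewrite vge_bar.
split=> [[y y0 ->]|a1]; first by rewrite -[1]addr0; apply/vgeM/y0/(vgeE _ vt).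
exists (tofrac a / t); last by rewrite mulrCA mulfV ?mulr1// (val_neq0 vt).
by rewrite -(subrr 1); exact: vge_divr.
Qed.

(** By residual rationality, the residue class of [x / y] has a representative
    in [R]. *)
Lemma same_val x y z : v x = z%:E -> v y = z%:E ->
  exists a, vge (z + 1) (x - tofrac a * y).
Proof.
move=> vx vy; have [_ _ vt] := Rbar_dvr.
have [_ /(_ (x / y))[]] := R_resrat.
  rewrite vge_bar -(subrr z); apply: vge_divr => //; exact/(vgeE _ vx).
move=> a [u]; rewrite vge_bar => u0 E; exists a.
have -> : x - tofrac a * y = t * u * y.
  by rewrite -E mulrBl divfK// (val_neq0 vy).
rewrite [z + 1]addrC; apply: vgeM; last exact/(vgeE _ vy).
by rewrite -[1]addr0; apply/vgeM/u0/(vgeE _ vt).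
Qed.

(** Fractional ideals seen through the valuation: the submodules of [K] that
    are commensurable with the valuation ring. *)
Definition lattice M : Prop :=
  [/\ submod M, exists e, vge e `<=` M & exists b, M `<=` vge b].

(** If a smaller submodule has the same values, an element can be corrected
    by elements of it until its value is beyond the conductor. *)
Lemma sub_of_values M N e : submod M -> submod N -> N `<=` M ->
  vge e `<=` N -> vset v M `<=` vset v N -> M `<=` N.
Proof.
move=> sM sN NM eN MN.
have H (k : nat) x : M x -> vge (e - k%:Z) x -> N x.
  elim: k x => [|k IHk] x Mx kx; first by apply: eN; rewrite subr0 in kx.
  have [|kx'] := pselect (vge (e - k%:Z) x); first exact: IHk.
  have vx : v x = (e - k.+1%:Z)%:E.
    apply: vge_next => //; move: kx'; congr (~ vge _ _); lia.
  have /MN/vsetP[y Ny vy] : vset v M (e - k.+1%:Z) by apply/vsetP; exists x.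
  have [a ha] := same_val vx vy.
  have Nay : N (tofrac a * y) by case: sN => _ _; apply.
  have -> : x = (x - tofrac a * y) + tofrac a * y by rewrite subrK.
  case: (sN) => _ ND _; apply: ND => //; apply: IHk.
    by apply: submodB => //; exact: NM.
  by apply: vgeW ha; lia.
move=> x Mx; have [->|x0] := eqVneq x 0; first by case: sN.
have [z vz] := val_fin x0; apply: (H `|e - z|%N) => //.
by apply/(vgeE _ vz); lia.
Qed.

Lemma vset_ge M e : vge e `<=` M -> forall z, e <= z -> vset v M z.
Proof.
move=> eM z ez; have [x vx] := val_surj z.
by apply/vsetP; exists x => //; apply: eM; exact/(vgeE _ vx).
Qed.

Lemma vset_sub M N : N `<=` M -> vset v N `<=` vset v M.
Proof. by move=> NM z /vsetP[x /NM Mx vx]; apply/vsetP; exists x. Qed.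

Definition value_gap M N (S : seq int) : Prop :=
  uniq S /\ forall z, z \in S <-> vset v M z /\ ~ vset v N z.

Lemma value_gap_ex M N : lattice M -> lattice N -> exists S, value_gap M N S.
Proof.
move=> [sM _ [b Mb]] [sN [e eN] _].
exists [seq z <- [seq b + i%:Z | i <- iota 0 `|e - b|] |
          `[< vset v M z /\ ~ vset v N z >]]; split.
  apply: filter_uniq; rewrite map_inj_uniq ?iota_uniq// => i j; lia.
move=> z; rewrite mem_filter; split=> [/andP[/asboolP]//|H].
rewrite asboolT//=; case: H => Mz Nz.
have bz : b <= z by case/vsetP: Mz => x /Mb bx vx; apply/(vgeE _ vx).
have ze : z < e by rewrite ltNge; apply/negP => /(vset_ge eN).
by apply/mapP; exists `|z - b|%N; rewrite ?mem_iota; lia.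
Qed.

Lemma seq_int_max (S : seq int) : S != [::] ->
  exists2 z, z \in S & forall u, u \in S -> u <= z.
Proof.
elim: S => // a [_ _|c S /(_ isT)[z zS mz] _].
  by exists a; rewrite ?mem_head// => u; rewrite inE => /eqP->.
have [az|za] := leP a z.
  exists z; first by rewrite inE zS orbT.
  by move=> u; rewrite inE => /predU1P[->|/mz].
exists a; first exact: mem_head.
by move=> u; rewrite inE => /predU1P[->//|/mz uz]; rewrite (le_trans uz)// ltW.
Qed.

(** If [z] is the largest missing value, the elements of [M] that agree with an
    element of [N] up to value [z] form a submodule with exactly the one new
    value [z], and the construction goes on from there. *)
Lemma chain_of_values M N S : lattice M -> lattice N -> N `<=` M ->
  value_gap M N S -> submod_chain M N (size S).
Proof.
move: {2}(size S) (erefl (size S)) => k.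
elim: k S N => [|k IHk] S N Sk lM lN NM [uS hS]; rewrite Sk;
    case: (lM) (lN) => sM _ [b Mb] [sN [e eN] _].
  have MN : M = N.
    apply/seteqP; split=> //; apply: (sub_of_values sM sN NM eN) => z Mz.
    apply: contrapT => Nz; have /hS : vset v M z /\ ~ vset v N z by [].
    by rewrite (size0nil Sk).
  exists (fun=> M); split=> //; by rewrite MN.
have [|z zS mz] := @seq_int_max S; first by case: (S) Sk.
have [/vsetP[x Mx vx] Nz] := (hS z).1 zS.
pose N' := M `&` addS N (vge z).
have sN' : submod N' by apply: submodI sM (addS_submod sN (vge_submod _)).
have NN' : N `<=` N'.
  by move=> y Ny; split; [exact: NM|exact: addSl (vge_submod _) _ Ny].
have lN' : lattice N'.
  split=> //; first by exists e => y /eN /NN'.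
  by exists b => y [/Mb].
have N'x : N' x by split=> //; apply: addSr => //; exact/(vgeE _ vx).
apply: (@chain_cons _ _ _ N' _ sN).
  by split=> // N'N; apply: Nz; apply/vsetP; exists x => //; exact: N'N.
have Sk' : size (rem z S) = k by rewrite size_rem// Sk.
rewrite -Sk'; apply: IHk => //; first by move=> y [].
split; first exact: rem_uniq.
move=> u; rewrite mem_rem_uniq// inE; split.
  move=> /andP[/eqP uz /[dup] uS' /hS[Mu Nu]]; split=> //.
  case/vsetP=> y [My [y1 [y2 [Ny1 zy2 E]]]] vy; apply: Nu.
  have uz' : u < z by rewrite lt_neqAle mz// andbT; exact/eqP.
  apply/vsetP; exists y1 => //.
  have -> : y1 = y - y2 by rewrite E addrK.
  apply: val_addl => //; rewrite -mulN1r -[u + 1]add0r; apply: vgeM.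
    by apply: Rk_vge0; exists (-1) => //; rewrite rmorphN1.
  by apply: vgeW zy2; lia.
move=> [Mu Nu]; apply/andP; split; last by apply/hS; split=> // /(vset_sub NN').
by apply/eqP => uz; apply: Nu; rewrite uz; apply/vsetP; exists x.
Qed.

(** By [sub_of_values], each strict step of a chain picks up a new value. *)
Lemma chain_le_values M N S l : lattice M -> lattice N ->
  value_gap M N S -> submod_chain M N l -> (l <= size S)%N.
Proof.
move=> [_ _ _] [_ [e eN] _] [uS hS] [C [C0 Cl sC ltC]].
have C_up i j : (i <= j <= l)%N -> C i `<=` C j by exact: chain_mono.
have eC i : (i <= l)%N -> vge e `<=` C i.
  by move=> il; apply: subset_trans eN _; rewrite -C0; apply: C_up.
pose cnt i := count (fun z => `[< vset v (C i) z >]) S.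
have cnt_ge i : (i <= l)%N -> (i <= cnt i)%N.
  elim: i => // i IHi il; apply: leq_ltn_trans (IHi (ltnW il)) _.
  have [CC nCC] := ltC i il.
  have [z Cz nCz] : exists2 z, vset v (C i.+1) z & ~ vset v (C i) z.
    apply: contrapT => nz; apply: nCC.
    apply: (sub_of_values (sC _ il) (sC _ (ltnW il)) CC (eC _ (ltnW il))).
    by move=> z Cz; apply: contrapT => nCz; apply: nz; exists z.
  have zS : z \in S.
    apply/hS; rewrite -C0 -Cl; split.
      by apply: vset_sub Cz; apply: C_up; rewrite il leqnn.
    by move=> Cz0; apply: nCz; apply: vset_sub Cz0; apply: C_up; exact: ltnW.
  rewrite /cnt -!size_filter.
  have := @uniq_leq_size _ (z :: [seq u <- S | `[< vset v (C i) u >]])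
    [seq u <- S | `[< vset v (C i.+1) u >]].
  apply=> /=; first by rewrite mem_filter asboolF//= filter_uniq.
  move=> u; rewrite inE mem_filter => /predU1P[->|].
    by rewrite mem_filter zS andbT; apply/asboolP.
  rewrite mem_filter => /andP[/asboolP Cu ->]; rewrite andbT; apply/asboolP.
  exact: vset_sub CC _ Cu.
by apply: leq_trans (cnt_ge l (leqnn l)) _; exact: count_size.
Qed.

Lemma len_values M N S : lattice M -> lattice N -> N `<=` M ->
  value_gap M N S -> len M N = size S.
Proof.
move=> lM lN NM gS; apply: len_eq; first exact: chain_of_values.
by move=> l; exact: chain_le_values.
Qed.

Lemma len_chain_le M N l : lattice M -> lattice N -> submod_chain M N l ->
  (l <= len M N)%N.
Proof.
move=> lM lN cl; have [S gS] := value_gap_ex lM lN.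
by rewrite (len_values lM lN (chain_sub cl) gS); exact: chain_le_values gS cl.
Qed.

Lemma len_chain M N : lattice M -> lattice N -> N `<=` M ->
  submod_chain M N (len M N).
Proof.
move=> lM lN NM; have [S gS] := value_gap_ex lM lN.
by rewrite (len_values lM lN NM gS); exact: chain_of_values.
Qed.

Lemma lenD M N P : lattice M -> lattice N -> lattice P -> N `<=` M ->
  P `<=` N -> len M P = (len M N + len N P)%N.
Proof.
move=> lM lN lP NM PN.
have [S [uS hS]] := value_gap_ex lM lN; have [T [uT hT]] := value_gap_ex lN lP.
rewrite (len_values lM lN NM (conj uS hS)) (len_values lN lP PN (conj uT hT)).
rewrite -size_cat; apply: len_values => //; first exact: subset_trans PN NM.
split.
  rewrite cat_uniq uS uT andbT /=; apply/hasPn => z /hT[Nz _].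
  by apply/negP => /hS[].
move=> z; rewrite mem_cat; split=> [/orP[/hS[Mz Nz]|/hT[Nz Pz]]|[Mz Pz]].
- by split=> // /(vset_sub PN).
- by split=> //; exact: (vset_sub NM).
apply/orP; have [Nz|Nz] := pselect (vset v N z).
  by right; apply/hT.
by left; apply/hS.
Qed.

Lemma len_self M : lattice M -> len M M = 0%N.
Proof. by move=> lM; rewrite (@len_values _ _ [::])//; split=> // z; split=> // -[]. Qed.

Lemma len_gt0 M N : lattice M -> lattice N -> N `<` M -> (0 < len M N)%N.
Proof.
move=> lM lN NM; apply: len_chain_le => //; case: (lM) (lN) => sM _ _ [sN _ _].
by apply: (chain_cons sN NM); exists (fun=> M); split.
Qed.

(** The hypotheses say that [Q] is [a M + P] and that multiplication by [a]
    induces a surjection of [M / M'] onto [Q / P]; a longest chain between [P]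
    and [Q] pulls back to a chain between [M'] and [M]. *)
Lemma len_mul_quo a M M' P Q : lattice M -> lattice M' -> lattice P ->
    lattice Q -> M' `<=` M -> P `<=` Q ->
    (forall x, M' x -> P (a * x)) ->
    (forall x, M x -> Q (a * x)) ->
    (forall y, Q y -> exists x p, [/\ M x, P p & y = a * x + p]) ->
  (len Q P <= len M M')%N.
Proof.
move=> lM lM' lP lQ MM' PQ aM' aMQ QaM.
have [sM [e' _] [b bM]] := lM; have [sM' [e eM'] _] := lM'.
have [C [C0 Cl sC ltC]] := len_chain lQ lP PQ.
pose D i := M `&` [set x | C i (a * x)].
have sD i : (i <= len Q P)%N -> submod (D i).
  by move=> /sC sCi; apply: submodI => //; exact: preim_submod.
have C_P i : (i <= len Q P)%N -> P `<=` C i.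
  by move=> il; rewrite -C0; apply: chain_mono ltC _.
have M'D0 : M' `<=` D 0%N by move=> x M'x; split; [exact: MM'|rewrite /= C0; exact: aM'].
have lD0 : lattice (D 0%N).
  split; [exact: sD|by exists e => x /eM' /M'D0|by exists b => x [/bM]].
have chD : submod_chain M (D 0%N) (len Q P).
  exists D; split=> //.
    by apply/seteqP; split=> x; [case|move=> Mx; split=> //=; rewrite Cl; exact: aMQ].
  move=> i il; have [CC nCC] := ltC i il; split; first by move=> x [Mx /CC].
  move=> DD; apply: nCC => y Cy.
  have C_Q : C i.+1 `<=` Q.
    by rewrite -Cl; apply: chain_mono ltC _; rewrite il leqnn.
  have [x [p [Mx Pp E]]] := QaM y (C_Q y Cy).
  have Cp : C i p by apply: C_P (ltnW il) _ Pp.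
  have Cax : C i.+1 (a * x).
    have -> : a * x = y - p by rewrite E addrK.
    by apply: submodB => //; [exact: sC|exact: CC].
  have [_ Cix] : D i x by exact: DD.
  by rewrite E; have [_ CD _] := sC i (ltnW il); apply: CD.
have D0M : D 0%N `<=` M by move=> x [].
by rewrite (lenD lM lD0 lM' D0M M'D0) (leq_trans (len_chain_le lM lD0 chD))// leq_addr.
Qed.

(** * Lattices and their duals *)

Lemma lattice_between M N P : submod N -> lattice M -> lattice P ->
  M `<=` N -> N `<=` P -> lattice N.
Proof.
move=> sN [_ [e eM] _] [_ _ [b Pb]] MN NP; split=> //.
  by exists e; exact: subset_trans eM MN.
by exists b; exact: subset_trans NP Pb.
Qed.

Lemma lattice_val M : lattice M -> exists x z, M x /\ v x = z%:E.
Proof.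
move=> [_ [e eM] _]; have [x vx] := val_surj e.
by exists x, e; split=> //; apply: eM; exact/(vgeE _ vx).
Qed.

Lemma lattice_add A B : lattice A -> lattice B -> lattice (addS A B).
Proof.
move=> [sA [e eA] [b Ab]] [sB _ [b' Bb']]; split; first exact: addS_submod.
  by exists e => x /eA; exact: addSl.
exists (Order.min b b'); apply: addS_min; first exact: vge_submod.
  by move=> x /Ab; apply: vgeW; rewrite ge_min lexx.
by move=> x /Bb'; apply: vgeW; rewrite ge_min lexx orbT.
Qed.

Lemma lattice_vge_cap M n : lattice M -> lattice (M `&` vge n).
Proof.
move=> [sM [e eM] [b Mb]]; split; first exact: submodI sM (vge_submod n).
  exists (Order.max e n) => x ex; split.
    by apply: eM; apply: vgeW ex; rewrite le_max lexx.
  by apply: vgeW ex; rewrite le_max lexx orbT.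
by exists b => x [/Mb].
Qed.

Lemma lattice_vge n : lattice (vge n).
Proof. by split; [exact: vge_submod|exists n|exists n]. Qed.

Lemma lattice_colon A B : lattice A -> lattice B -> lattice (colon A B).
Proof.
move=> [sA [e eA] [b Ab]] lB; have [y [z [By vy]]] := lattice_val lB.
have [_ _ [b' Bb']] := lB; split; first exact: colon_submod.
  exists (e - b') => x ex u /Bb' b'u; apply: eA.
  by rewrite -(subrK b' e); exact: vgeM.
exists (b - z) => x /(_ y By) /Ab bxy.
by rewrite -(mulfK (val_neq0 vy) x); exact: vge_divr.
Qed.

Lemma lattice_mulS A B : lattice A -> lattice B -> lattice (mulS A B).
Proof.
move=> lA [sB [e eB] [b Bb]]; have [x [z [Ax vx]]] := lattice_val lA.
have [_ _ [b' Ab']] := lA; split; first exact: mulS_submod.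
  exists (e + z) => y ezy; rewrite -(mulVKf (val_neq0 vx) y); apply: mulS_mul => //.
  by apply: eB; rewrite mulrC -(addrK z e); exact: vge_divr.
exists (b' + b); apply: mulS_min; first exact: vge_submod.
by move=> a c /Ab' ? /Bb ?; exact: vgeM.
Qed.

(** The integral closure is a finite module, so a common denominator of its
    generators multiplies it into [R]: the conductor is nonzero. *)
Lemma lattice_Rk : lattice (Rk R).
Proof.
split; [exact: Rk_submod| |by exists 0; exact: Rk_vge0].
have [n [g Rbar_g]] := Rbar_finite.
have [d d0 dg] : exists2 d : R, d != 0 & forall i, Rk R (tofrac d * g i).
  have [f f_den] : {f : 'I_n -> R &
      forall i, f i != 0 /\ Rk R (tofrac (f i) * g i)}.
    apply: (@choice _ _ (fun i d => d != 0 /\ Rk R (tofrac d * g i))) => i.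
    by have [d d0 dg] := frac_den (g i); exists d.
  exists (\prod_i f i); first by apply/prodf_neq0 => i _; case: (f_den i).
  move=> i; rewrite (bigD1 i)//= rmorphM /= mulrAC; apply: Rk_mul.
    by case: (f_den i).
  by exists (\prod_(j | j != i) f j).
have [z vd] : exists z, v (tofrac d) = z%:E by apply: val_fin; rewrite tofrac_eq0.
exists z => x zx.
have : int_closure R (x / tofrac d).
  by rewrite vge_bar -(subrr z); exact: vge_divr.
rewrite Rbar_g => -[a _ E]; rewrite -(mulfVK (val_neq0 vd) x) -E mulr_suml.
have [R0 RD _] := Rk_submod R.
apply: (big_ind (Rk R)) => // i _; rewrite -mulrA [g i * _]mulrC.
by apply: Rk_mul => //; exists (a i).
Qed.

Lemma lattice_fractional M : lattice M -> fractional_ideal M /\ M <> [set 0].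
Proof.
move=> lM; have [sM _ [b Mb]] := lM; split; last first.
  move=> M0; have [x [z [+ vx]]] := lattice_val lM.
  by rewrite M0 => /eqP; rewrite (negPf (val_neq0 vx)).
have [_ [c cR] _] := lattice_Rk; split=> //.
have [y vy] := val_surj (Order.max c (c - b)).
have [d _ dy] : Rk R y by apply: cR; apply/(vgeE _ vy); rewrite le_max lexx.
exists d; split; first by rewrite -tofrac_eq0 dy (val_neq0 vy).
move=> x /Mb bx; apply: cR; rewrite dy -(subrK b c); apply: vgeM => //.
by apply/(vgeE _ vy); rewrite le_max lexx orbT.
Qed.

(** Elements of value zero are units: [x R] has the values of [R], hence it is
    all of [R]. *)
Lemma unit_Rk x : Rk R x -> v x = 0%:E -> Rk R x^-1.
Proof.
move=> Rx vx; have [sR [c cR] _] := lattice_Rk.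
have x0 := val_neq0 vx.
suff /(_ 1 (Rk1 R))[a Ra xa1] : Rk R `<=` scal x (Rk R).
  by rewrite -(mulKf x0 a) xa1 mulr1 in Ra.
apply: (@sub_of_values _ _ c) => //.
- exact: scal_submod.
- by move=> _ [a Ra <-]; exact: Rk_mul.
- move=> y cy; exists (y / x); last by rewrite mulrCA mulfV ?mulr1.
  by apply: cR; rewrite -[c]subr0; exact: vge_divr.
- move=> z /vsetP[a Ra va]; apply/vsetP; exists (x * a); first by exists a.
  by rewrite valM vx va add0e.
Qed.

Lemma emb_mE : emb m = Rk R `&` vge 1.
Proof.
apply/seteqP; split=> [_ [a ma <-]|_ [[a _ <-] a1]].
  by split; [exists a|apply/m_vge].
by exists a => //; apply/m_vge.
Qed.

(** Take an element of largest value among those of [B] outside [A]: products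
    with elements of [m] have larger value, so they fall into [A]. *)
Lemma socle_elt A B : lattice A -> lattice B -> A `<=` B -> ~ B `<=` A ->
  exists x, [/\ B x, ~ A x & forall a, emb m a -> A (a * x)].
Proof.
move=> [sA [e eA] _] [sB _ _] AB nBA.
pose P (k : nat) := `[< exists x, [/\ B x, ~ A x & vge (e - k%:Z) x] >].
have exP : exists k, P k.
  have [x Bx Ax] : exists2 x, B x & ~ A x.
    by apply: contrapT => nx; apply: nBA => x Bx; apply: contrapT => Ax; apply: nx; exists x.
  have [z vz] : exists z, v x = z%:E.
    by apply: val_fin; apply/eqP => x0; apply: Ax; rewrite x0; case: sA.
  exists `|e - z|%N; apply/asboolP; exists x; split=> //.
  by apply/(vgeE _ vz); lia.
have [k /asboolP[x [Bx Ax kx]] kmin] := ex_minnP exP.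
exists x; split=> // a; rewrite emb_mE => -[Ra a1]; apply: contrapT => Aax.
have Bax : B (a * x) by exact: submodZ.
have kax := vgeM a1 kx; case: k => [|k] in kx kmin kax *.
  by apply: Aax; apply: eA; apply: vgeW kax; lia.
have /kmin : P k; last by rewrite ltnn.
by apply/asboolP; exists (a * x); split=> //; apply: vgeW kax; lia.
Qed.

Variable w : set {fraction R}.
Hypothesis w_canonical : canonical_ideal w.
Hypothesis R_le_w : Rk R `<=` w.
Hypothesis w_le_Rbar : w `<=` int_closure R.

Lemma w_vge0 : w `<=` vge 0.
Proof. by rewrite -vge_bar. Qed.

Lemma lattice_w : lattice w.
Proof.
have [[sw _] _ _] := w_canonical.
exact: lattice_between sw lattice_Rk (lattice_vge 0) R_le_w w_vge0.
Qed.

Lemma w1 : w 1.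
Proof. exact/R_le_w/Rk1. Qed.

Lemma sub_mulS A : A `<=` mulS w A.
Proof. by move=> x Ax; rewrite -[x]mul1r; apply: mulS_mul => //; exact: w1. Qed.

Lemma dualK J : lattice J -> colon w (colon w J) = J.
Proof. by move=> /lattice_fractional[]; have [_ _] := w_canonical; apply. Qed.

Lemma colon_ww : colon w w = Rk R.
Proof.
by have [sw _ _] := lattice_w; have := dualK lattice_Rk; rewrite colon1.
Qed.

(** This is [w : w J = (w : w) : J]; it expresses duals into [R] by duals into
    [w], which preserve lengths. *)
Lemma starE J : star J = colon w (mulS w J).
Proof. by rewrite colon_mulS ?colon_ww//; case: lattice_w. Qed.

Lemma dual_star J : lattice J -> colon w (star J) = mulS w J.
Proof. by move=> lJ; rewrite starE dualK//; exact: lattice_mulS lattice_w lJ. Qed.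

(** Reversing a chain by [w : _] keeps the inclusions strict because a second
    application recovers each term. *)
Lemma len_dual_le A B : lattice A -> lattice B -> A `<=` B ->
  (len B A <= len (colon w A) (colon w B))%N.
Proof.
move=> lA lB AB; have [C [C0 Cl sC ltC]] := len_chain lB lA AB.
have lC i : (i <= len B A)%N -> lattice (C i).
  move=> il; apply: (lattice_between (sC i il) lA lB).
    by rewrite -[X in X `<=` _]C0; apply: chain_mono ltC _.
  by rewrite -[X in _ `<=` X]Cl; apply: chain_mono ltC _; rewrite il leqnn.
apply: len_chain_le; [exact: lattice_colon lattice_w lA
  |exact: lattice_colon lattice_w lB|].
exists (fun i => colon w (C (len B A - i)%N)); split.
- by rewrite subn0 Cl.
- by rewrite subnn C0.
- by move=> i il; apply: colon_submod; case: lattice_w.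
move=> i il; have := ltC (len B A - i.+1)%N.
rewrite -subSn// subSS => /(_ _)[|CC nCC]; first by lia.
split; first exact: colonS.
move=> /(@colonS _ w); rewrite !dualK//; apply: lC; lia.
Qed.

Lemma len_dual A B : lattice A -> lattice B -> A `<=` B ->
  len (colon w A) (colon w B) = len B A.
Proof.
move=> lA lB AB; apply/eqP; rewrite eqn_leq len_dual_le// andbT.
rewrite -{2}(dualK lA) -{2}(dualK lB); apply: len_dual_le.
- exact: lattice_colon lattice_w lB.
- exact: lattice_colon lattice_w lA.
- exact: colonS.
Qed.

Lemma len_star J : lattice J -> J `<=` Rk R ->
  len (star J) (Rk R) = len w (mulS w J).
Proof.
move=> lJ JR; rewrite starE -colon_ww.
apply: len_dual (lattice_mulS lattice_w lJ) lattice_w _.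
apply: mulS_min; first by case: lattice_w.
by move=> a b wa /JR Rb; rewrite mulrC; apply: submodZ => //; case: lattice_w.
Qed.

Lemma star_anti A B : A `<=` B -> star B `<=` star A.
Proof. exact: colonS. Qed.

Lemma sub_star2 A : A `<=` star (star A).
Proof. by move=> x Ax y; rewrite mulrC; apply. Qed.

Lemma star3 A : star (star (star A)) = star A.
Proof.
by apply/seteqP; split; [exact/star_anti/sub_star2|exact: sub_star2].
Qed.

Lemma lattice_star J : lattice J -> lattice (star J).
Proof. exact: lattice_colon lattice_Rk. Qed.

Lemma starR : star (Rk R) = Rk R.
Proof. by rewrite /star colon1//; exact: Rk_submod. Qed.

Lemma Rk_sub_star J : J `<=` Rk R -> Rk R `<=` star J.
Proof. by move=> /star_anti; rewrite starR. Qed.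

Lemma star2_sub_Rk J : J `<=` Rk R -> star (star J) `<=` Rk R.
Proof. by move=> /Rk_sub_star/star_anti; rewrite starR. Qed.

(** * The upper bound for the colength of the dual *)

Lemma lattice_m : lattice (emb m).
Proof. by rewrite emb_mE; exact: lattice_vge_cap lattice_Rk. Qed.

(** One less than the number of generators of [w]: the unit is part of a
    minimal system of generators. *)
Definition gens_mod1 : nat := len w (addS (Rk R) (mulS w (emb m))).

Lemma wm_sub_vge1 : mulS w (emb m) `<=` vge 1.
Proof.
apply: mulS_min; first exact: vge_submod.
move=> a b /w_vge0 a0; rewrite emb_mE => -[_ b1].
by rewrite -[1]add0r; exact: vgeM.
Qed.

Lemma w_min J : J `<=` Rk R -> addS (Rk R) (mulS w J) `<=` w.
Proof.
move=> JR; have [sw _ _] := lattice_w; apply: addS_min => //.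
by apply: mulS_min => // a b wa /JR Rb; rewrite mulrC; exact: submodZ.
Qed.

(** By duality [r] is the length of [w / m w], and [R + m w] is strictly larger
    than [m w] since [1] has value zero. *)
Lemma gens_mod1_lt : (gens_mod1 < cm_type m)%N.
Proof.
have mR : emb m `<=` Rk R by exact: emb_sub_Rk.
have lwm := lattice_mulS lattice_w lattice_m.
have lN := lattice_add lattice_Rk lwm.
rewrite /cm_type -/(star _) (len_star lattice_m mR).
rewrite (lenD lattice_w lN lwm (w_min mR)); last by apply: addSr; case: lattice_Rk.
rewrite -[X in (X < _)%N]addn0 ltn_add2l; apply: len_gt0 => //; split.
  by apply: addSr; case: lattice_Rk.
have R1 : addS (Rk R) (mulS w (emb m)) 1 by apply: addSl (Rk1 R); case: lwm.
by move=> /(_ 1 R1)/wm_sub_vge1; rewrite (vgeE _ val1).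
Qed.

Section GeneratorBound.
Variable N : set {fraction R}.
Hypothesis lN : lattice N.
Hypothesis R_le_N : Rk R `<=` N.

Let W A := addS (mulS w A) N.

Let lW A : lattice A -> lattice (W A).
Proof. by move=> lA; exact: lattice_add (lattice_mulS lattice_w lA) lN. Qed.

Let WS A B : A `<=` B -> W A `<=` W B.
Proof.
move=> AB; have [sN _ _] := lN.
apply: addS_min; first exact: addS_submod (mulS_submod _ _) sN.
  apply: subset_trans (addSl sN); apply: mulS_min; first exact: mulS_submod.
  by move=> a b wa /AB Bb; exact: mulS_mul.
exact: addSr (mulS_submod _ _).
Qed.

(** When [m x] lies in [A], multiplication by [x] maps [w / (R + m w)] onto the
    quotient. *)
Lemma len_simple_step A x : lattice A -> Rk R x ->
    lattice (addS A (scal x (Rk R))) -> (forall a, emb m a -> A (a * x)) ->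
  (len (W (addS A (scal x (Rk R)))) (W A) <= gens_mod1)%N.
Proof.
move=> lA Rx lA' mxA; have [sA _ _] := lA; have [sN _ _] := lN.
have sx := scal_submod x (Rk_submod R).
have sWA : submod (W A) by case: (lW lA).
apply: (@len_mul_quo x) => //.
- exact: lattice_w.
- exact: lattice_add lattice_Rk (lattice_mulS lattice_w lattice_m).
- exact: lW.
- exact: lW.
- by apply: w_min; exact: emb_sub_Rk.
- by apply: WS; exact: addSl.
- apply: (@addS_min _ _ _ [set y | W A (x * y)]); first exact: preim_submod.
    by move=> y Ry /=; apply: (addSr (mulS_submod _ _)); apply: R_le_N; exact: Rk_mul.
  apply: mulS_min; first exact: preim_submod.
  move=> a b wa mb /=; rewrite mulrCA; apply: addSl => //.
  by apply: mulS_mul => //; rewrite mulrC; exact: mxA.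
- move=> y wy; apply: addSl => //; rewrite mulrC; apply: mulS_mul => //.
  by apply: addSr => //; exists 1; [exact: Rk1|rewrite mulr1].
move=> y; have [sw _ _] := lattice_w.
suff /(_ y) WS' : W (addS A (scal x (Rk R))) `<=` addS (scal x w) (W A).
  by move=> /WS'[_ [p [[z wz <-] Wp ->]]]; exists z, p.
have sS := addS_submod (scal_submod x sw) sWA.
apply: addS_min => //; last first.
  apply: subset_trans (addSr (scal_submod x sw)); exact: addSr (mulS_submod _ _).
apply: mulS_min => // z _ wz [b [_ [Ab [c Rc <-] ->]]].
exists (x * (c * z)), (z * b); split; last by ring.
  by exists (c * z) => //; exact: submodZ.
by apply: addSl => //; exact: mulS_mul.
Qed.

(** [B] is reached from [A] by adjoining socle elements one at a time; each
    adjunction increases the length over [A], and by [len_simple_step] costs at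
    most [gens_mod1] on the left. *)
Lemma len_gens_bound A B : lattice A -> lattice B -> A `<=` B -> B `<=` Rk R ->
  (len (W B) (W A) <= gens_mod1 * len B A)%N.
Proof.
move: {2}(len B A) (leqnn (len B A)) => k.
elim: k A => [|k IHk] A kle lA lB AB BR;
  (have [BA|nBA] := pselect (B `<=` A);
    first by have -> : B = A by [exact/seteqP]; rewrite len_self//; exact: lW).
  by move: kle; rewrite leqNgt len_gt0.
have [x [Bx Ax mxA]] := socle_elt lA lB AB nBA.
have [sA _ _] := lA; have [sB _ _] := lB.
have sx := scal_submod x (Rk_submod R).
set A' := addS A (scal x (Rk R)).
have AA' : A `<=` A' by exact: addSl.
have A'B : A' `<=` B.
  apply: addS_min => // _ [a Ra <-]; rewrite mulrC; exact: submodZ.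
have lA' : lattice A' := lattice_between (addS_submod sA sx) lA lB AA' A'B.
have A'A : (0 < len A' A)%N.
  apply: len_gt0 => //; split=> // /(_ x) A'A; apply/Ax/A'A.
  by apply: addSr => //; exists 1; [exact: Rk1|rewrite mulr1].
have lenBA := lenD lB lA' lA A'B AA'.
rewrite lenBA (lenD (lW lB) (lW lA') (lW lA) (WS A'B) (WS AA')) mulnDr.
apply: leq_add; first by apply: IHk => //; lia.
apply: leq_trans (len_simple_step lA (BR _ Bx) lA' mxA) _.
by rewrite -{1}[gens_mod1]muln1 leq_mul2l A'A orbT.
Qed.

End GeneratorBound.

(** [w / (R + w J)] is generated by [r - 1] elements and killed by both [J] and
    the different, while [(R + w J) / w J] is a quotient of [R / J]; the two
    lengths add up to the length of [w / w J]. *)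
Lemma len_star_upper J : lattice J -> J `<=` Rk R ->
  (len (star J) (Rk R) <=
     (cm_type m).-1 * len (Rk R) (addS J (different w)) + len (Rk R) J)%N.
Proof.
move=> lJ JR; have [sw _ _] := lattice_w; have [sJ _ _] := lJ.
have lwJ := lattice_mulS lattice_w lJ; have [swJ _ _] := lwJ.
have lN := lattice_add lattice_Rk lwJ; set N := addS (Rk R) _ in lN.
have [sN _ _] := lN.
have RN : Rk R `<=` N by exact: addSl.
have wJN : mulS w J `<=` N by apply: addSr; exact: Rk_submod.
rewrite len_star// (lenD lattice_w lN lwJ (w_min JR) wJN).
apply: leq_add; last first.
  apply: (@len_mul_quo 1) => //; first exact: lattice_Rk.
  - by move=> x Jx; rewrite mul1r; exact: sub_mulS.
  - by move=> x Rx; rewrite mul1r; exact: RN.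
  by move=> y [x [p [Rx wp ->]]]; exists x, p; rewrite mul1r.
have lth : lattice (different w) := lattice_star lattice_w.
have thR : different w `<=` Rk R by move=> x /(_ _ w1); rewrite mulr1.
have lA := lattice_add lJ lth; set A := addS J _ in lA *.
have AR : A `<=` Rk R by apply: addS_min => //; exact: Rk_submod.
have /(_ (fun _ => id)) := len_gens_bound lN RN lA lattice_Rk AR.
have -> : addS (mulS w (Rk R)) N = w.
  apply/seteqP; split; last first.
    move=> x wx; apply: addSl => //; rewrite -[x]mulr1.
    by apply: mulS_mul => //; exact: Rk1.
  apply: addS_min => //; last exact: w_min.
  by apply: mulS_min => // a b wa Rb; rewrite mulrC; exact: submodZ.
have -> : addS (mulS w A) N = N.
  apply/seteqP; split; last by apply: addSr; exact: mulS_submod.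
  apply: addS_min => //; apply: mulS_min => // a _ wa [j [d [Jj thd ->]]].
  have [_ ND _] := sN; rewrite mulrDr; apply: ND.
    by apply: wJN; exact: mulS_mul.
  by apply: RN; rewrite mulrC; exact: thd.
move=> /leq_trans; apply; rewrite leq_mul2r; apply/orP; right.
by have := gens_mod1_lt; lia.
Qed.

(** * The type sequence *)

Variable s : nat -> int.
Hypothesis s_enum : value_enum v s.

Lemma s_mono i j : (s i < s j) = (i < j)%N.
Proof.
have [s_lt _] := s_enum; have [ij|ji|->] := ltngtP i j; last exact: ltxx.
  exact: s_lt.
by apply/negbTE; rewrite -leNgt ltW// s_lt.
Qed.

Lemma s_inj : injective s.
Proof.
by move=> i j sij; have := s_mono i j; have := s_mono j i; rewrite sij ltxx; lia.
Qed.

Lemma s_val i : vset v (Rk R) (s i).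
Proof. by have [_ <-] := s_enum; exists i. Qed.

Lemma val_s z : vset v (Rk R) z -> exists i, s i = z.
Proof. by have [_ <-] := s_enum => -[i _ <-]; exists i. Qed.

Lemma s0 : s 0%N = 0.
Proof.
have [|i si] := @val_s 0; first by apply/vsetP; exists 1; [exact: Rk1|exact: val1].
have /vsetP[x /Rk_vge0 x0 vx] := s_val 0; move: x0; rewrite (vgeE _ vx) => s0_ge.
by have := s_mono i 0; rewrite si; lia.
Qed.

Lemma R_E i : R_ v s i = Rk R `&` vge (s i).
Proof. by []. Qed.

Lemma lattice_R_ i : lattice (R_ v s i).
Proof. exact: lattice_vge_cap lattice_Rk. Qed.

Lemma R_0 : R_ v s 0 = Rk R.
Proof.
by rewrite R_E s0; apply/seteqP; split=> [x []//|x Rx]; split=> //; exact: Rk_vge0.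
Qed.

Lemma R_1 : R_ v s 1 = emb m.
Proof.
rewrite emb_mE R_E; apply/seteqP; split=> x [Rx hx]; split=> //.
  by apply: vgeW hx; have := s_mono 0 1; rewrite s0; lia.
have [->|x0] := eqVneq x 0; first exact: vge_0.
have [z vz] := val_fin x0; apply/(vgeE _ vz).
have [|i si] := @val_s z; first by apply/vsetP; exists x.
move: hx; rewrite (vgeE _ vz) -si; have := s_mono i 1; have := s_mono 0 i.
by rewrite s0; lia.
Qed.

Lemma R_anti i : R_ v s i.+1 `<=` R_ v s i.
Proof. by move=> x [Rx hx]; split=> //; apply: vgeW hx; rewrite ltW// s_mono. Qed.

Lemma type_seq1 : type_seq v s 1 = cm_type m.
Proof. by rewrite /type_seq R_1 /= R_0 /cm_type -/(star (Rk R)) starR. Qed.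

(** [w R_i] contains an element of value [s i] while all elements of
    [w R_(i+1)] have larger values, and duality transports this strict
    inclusion to the duals. *)
Lemma type_seq_gt0 i : (0 < type_seq v s i.+1)%N.
Proof.
have lR := lattice_R_; apply: len_gt0; [exact: lattice_star|exact: lattice_star|].
split; first exact/star_anti/R_anti.
move=> /(@colonS _ w).
rewrite -/(star (R_ v s i)) -/(star (R_ v s i.+1)) !dual_star// => wRR.
have /vsetP[x Rx vx] := s_val i.
have : mulS w (R_ v s i.+1) x.
  by apply: wRR; apply: sub_mulS; rewrite R_E; split=> //; exact/(vgeE _ vx).
suff /[apply] : mulS w (R_ v s i.+1) `<=` vge (s i.+1).
  by rewrite (vgeE _ vx); have := s_mono i i.+1; lia.
apply: mulS_min; first exact: vge_submod.
by move=> a b /w_vge0 a0 [_ sb]; rewrite -[s i.+1]add0r; exact: vgeM.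
Qed.

Lemma len_star_R_ k :
  len (star (R_ v s k)) (Rk R) = (\sum_(i < k) type_seq v s i.+1)%N.
Proof.
elim: k => [|k IHk]; first by rewrite R_0 starR len_self ?big_ord0//; exact: lattice_Rk.
rewrite big_ord_recr /= -IHk addnC; have lR i := lattice_star (lattice_R_ i).
apply: lenD (lR _) (lR _) lattice_Rk _ _; first exact/star_anti/R_anti.
by apply: Rk_sub_star => x [].
Qed.

(** Only the values [s 0], ..., [s (k - 1)] can be missing in [M]. *)
Lemma len_values_lt M k : lattice M -> M `<=` Rk R -> R_ v s k `<=` M ->
  len (Rk R) M = size [seq i <- iota 0 k | ~~ `[< vset v M (s i) >]].
Proof.
move=> lM MR RM; rewrite -(size_map s); apply: len_values => //.
  exact: lattice_Rk.
split; first by rewrite (map_inj_uniq s_inj) filter_uniq// iota_uniq.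
move=> z; split.
  move=> /mapP[i]; rewrite mem_filter => /andP[/asboolPn Mi _] ->.
  by split=> //; exact: s_val.
move=> [/[dup] Rz /val_s[i si] Mz]; apply/mapP; exists i => //.
rewrite mem_filter asboolF ?si//= mem_iota /= add0n ltnNge; apply/negP => ki.
apply: Mz; case/vsetP: Rz => x Rx vx; apply/vsetP; exists x => //; apply: RM.
by split=> //; apply/(vgeE _ vx); rewrite -si leNgt s_mono -leqNgt.
Qed.

(** * The lower bound for the colength of the dual *)

Variable I : set R.
Hypothesis I_ideal : is_ideal I.
Hypothesis I_neq0 : I <> [set 0].
Hypothesis I_proper : I <> setT.

Lemma lattice_I : lattice (emb I).
Proof.
have [x Ix x0] : exists2 x, I x & x != 0.
  apply: contrapT => nx; apply: I_neq0; apply/seteqP; split=> [x Ix|_ ->] /=.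
    by apply/eqP; apply: contrapT => /negP x0; apply: nx; exists x.
  by case: I_ideal.
have [_ [c cR] [b Rb]] := lattice_Rk.
have [z vz] : exists z, v (tofrac x) = z%:E by apply: val_fin; rewrite tofrac_eq0.
split; [exact: emb_submod| |by exists b; exact: subset_trans (@emb_sub_Rk _ I) Rb].
exists (c + z) => y cy.
have [a _ ay] : Rk R (y / tofrac x) by apply: cR; rewrite -(addrK z c); exact: vge_divr.
exists (a * x); first by case: I_ideal => _ _; apply.
by rewrite rmorphM /= ay divfK// (val_neq0 vz).
Qed.

(** An element of [I] of value zero would be a unit of [R]. *)
Lemma I_sub_m : emb I `<=` emb m.
Proof.
move=> x Ix; rewrite emb_mE; split; first exact: emb_sub_Rk Ix.
have x0 : vge 0 x by apply/Rk_vge0/(emb_sub_Rk Ix).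
apply: contrapT => x1; have vx : v x = 0%:E := vge_next x0 x1.
have Rxi := unit_Rk (emb_sub_Rk Ix) vx.
have [a Ia a1] : emb I 1.
  by rewrite -(mulVf (val_neq0 vx)); apply: submodZ Rxi Ix; exact: emb_submod.
apply: I_proper; apply/seteqP; split=> // b _.
have -> : b = b * a by apply/eqP; rewrite -tofrac_eq rmorphM /= a1 mulr1.
by case: I_ideal => _ _; apply.
Qed.

(** The bidual is proper because the dual of the maximal ideal exceeds [R]. *)
Lemma star2_no_unit : ~ vset v (star (star (emb I))) 0.
Proof.
move=> /vsetP[y Iy vy].
have IR : emb I `<=` Rk R by exact: emb_sub_Rk.
have I1 : star (star (emb I)) 1.
  rewrite -(mulVf (val_neq0 vy)); apply: (submodZ _ _ Iy).
    by apply: colon_submod; exact: Rk_submod.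
  by apply: unit_Rk vy; exact: star2_sub_Rk IR _ Iy.
have := gens_mod1_lt; rewrite /cm_type -/(star (emb m)).
have -> : star (emb m) = Rk R; last by rewrite len_self//; exact: lattice_Rk.
apply/seteqP; split=> [x mx|]; last by apply: Rk_sub_star; exact: emb_sub_Rk.
have : star (star (star (emb I))) x by rewrite star3; exact: star_anti I_sub_m _ mx.
by move=> /(_ 1 I1); rewrite mulr1.
Qed.

(** [gamma I] is the largest set of the form [vge k] inside [I]: an ideal of the
    valuation ring that contains [x] contains all elements of value at least
    [v x]. The exponent [k] is itself a value of [R]. *)
Lemma gamma_R_ : exists k, gamma I = R_ v s k.
Proof.
have [_ [e eI] _] := lattice_I.
pose P (k : nat) := `[< vge k `<=` emb I >].
have exP : exists k, P k.
  by exists `|e|%N; apply/asboolP => x ex; apply: eI; apply: vgeW ex; lia.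
have [k /asboolP kI kmin] := ex_minnP exP.
have [j sj] : exists j, s j = k.
  by apply/val_s/(vset_ge _ (lexx _)) => x /kI/emb_sub_Rk.
exists j; rewrite R_E sj; apply/seteqP; split=> x; last first.
  move=> [_ kx]; exists (vge k); split=> //; split; [exact: vge_0|exact: vgeD| |].
    by move=> b y; rewrite vge_bar => b0 ky; rewrite -[k%:Z]add0r; exact: vgeM.
  by rewrite vge_bar; apply: vgeW.
move=> [L [[L0 LD LM _] LI Lx]]; split; first exact/(@emb_sub_Rk _ I)/LI.
have [->|x0] := eqVneq x 0; first exact: vge_0.
have [z vz] := val_fin x0.
have z0 : 0 <= z by apply/(vgeE _ vz)/Rk_vge0/(@emb_sub_Rk _ I)/LI.
apply/(vgeE _ vz).
suff /kmin : P `|z|%N by lia.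
apply/asboolP => y zy; apply: LI; rewrite -(divfK x0 y); apply: LM => //.
rewrite vge_bar -(subrr z); apply: vge_divr => //; apply: vgeW zy; lia.
Qed.

Lemma mem_V_ i : (i.+1 \in V_ v s I) = `[< vset v (star (star (emb I))) (s i) >].
Proof.
apply/idP/asboolP => [|Ii]; first by rewrite inE => -[h Ih [->]].
by rewrite inE; exists i.
Qed.

(** The sum of the whole type sequence up to [n_I] is the colength of the dual
    of [gamma_I]; the indices outside [V_ I] are as many as the values that
    the bidual misses, and the first of them contributes [r]. *)
Lemma len_star_lower :
  (cm_type m)%:Z + (len (Rk R) (star (star (emb I))))%:Z - 1 - d_ v s I
    <= (len (star (emb I)) (Rk R))%:Z.
Proof.
have [k gk] := gamma_R_; have lg : lattice (gamma I) by rewrite gk; exact: lattice_R_.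
have IR : emb I `<=` Rk R by exact: emb_sub_Rk.
have gI : gamma I `<=` emb I by move=> x [L [_ LI /LI]].
have lI2 := lattice_star (lattice_star lattice_I).
have nk : n_ I = k.
  rewrite /n_ (@len_values_lt _ k)//; last by rewrite gk.
    rewrite -[RHS](size_iota 0); congr size; apply/all_filterP/allP => i.
    rewrite mem_iota /= add0n => ik; apply/asboolPn.
    rewrite gk => /vsetP[x [_ sx] vx]; have /(vgeE _ vx) : vge (s k) x by [].
    by rewrite leNgt s_mono ik.
  exact: subset_trans gI IR.
have len_I2 : len (Rk R) (star (star (emb I))) =
    size [seq i <- iota 0 k | i.+1 \notin V_ v s I].
  rewrite (@len_values_lt _ k)//; first last.
  - by rewrite -gk; exact: subset_trans gI (@sub_star2 _).
  - exact: star2_sub_Rk.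
  by congr size; apply: eq_filter => i; rewrite mem_V_.
have len_g : (len (star (gamma I)) (star (emb I)) + len (star (emb I)) (Rk R) =
    \sum_(i < k) type_seq v s i.+1)%N.
  rewrite -len_star_R_ -gk -lenD//; [exact: lattice_star|
    exact/lattice_star/lattice_I|exact: lattice_Rk|exact: star_anti|].
  exact: Rk_sub_star.
have sumV : (\sum_(h < (n_ I).+1 | (h : nat) \in V_ v s I) type_seq v s h =
    \sum_(i < k | i.+1 \in V_ v s I) type_seq v s i.+1)%N.
  rewrite nk big_mkcond big_ord_recl /= [X in (X + _)%N]ifF ?add0n.
    by rewrite [RHS]big_mkcond; apply: eq_bigr.
  by apply/negP; rewrite inE => -[].
(* The index 1, which carries [r], has to be in the range of summation. *)
have k0 : (0 < k)%N.
  rewrite lt0n; apply/eqP => k0.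
  have /gI/I_sub_m : gamma I 1 by rewrite gk k0 R_0; exact: Rk1.
  by rewrite emb_mE => -[_]; rewrite (vgeE _ val1).
have lowV : (cm_type m + size [seq i <- iota 0 k | i.+1 \notin V_ v s I] <=
    (\sum_(i < k | i.+1 \notin V_ v s I) type_seq v s i.+1).+1)%N.
  rewrite -(big_mkord (fun i => i.+1 \notin V_ v s I) (fun i => type_seq v s i.+1)).
  rewrite /index_iota subn0 -big_filter.
  case: k k0 {gk nk len_I2 len_g sumV} => // k _ /=.
  rewrite mem_V_ asboolF /=; last by rewrite s0; exact: star2_no_unit.
  rewrite big_cons type_seq1 addnS ltnS leq_add2l -sum1_size.
  by apply: leq_sum => i _; exact: type_seq_gt0.
move: len_g; rewrite (bigID (fun i : 'I_k => i.+1 \in V_ v s I)) /= -sumV.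
rewrite /d_ -/(star (gamma I)) len_I2; move: lowV.
move: (\sum_(h < _ | _) _)%N (\sum_(i < k | _) _)%N (size _) => S1 S2 n.
lia.
Qed.

End Values.

(** * The inequalities *)

Theorem corollary3p11 (R : idomainType) (m : set R)
    (t : {fraction R}) (v : {fraction R} -> \bar int) (s : nat -> int)
    (w : set {fraction R}) (I : set R)
    (R_noetherian : noetherian R)
    (R_dim1 : krull_dim R 1)
    (R_local : local_ring m)
    (k_infinite : infinite_residue_field m)
    (Rbar_finite : fin_gen (int_closure R))
    (Rbar_dvr : is_dvr (int_closure R) t v)
    (R_resrat : residually_rational m t)
    (s_enum : value_enum v s)
    (w_canonical : canonical_ideal w)
    (R_le_w : Rk R `<=` w)
    (w_le_Rbar : w `<=` int_closure R)
    (I_ideal : is_ideal I)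
    (I_neq0 : I <> [set 0])
    (I_proper : I <> setT) :
  let r : int := (cm_type m)%:Z in
  let I1 := emb I in
  let I2 := star (star (emb I)) in
  let theta := different w in
  (a_ I <= (r - 1) * (len (Rk R) (addS I2 theta))%:Z - (len I2 I1)%:Z /\
   a_ I >= r - 1 - (len I2 I1)%:Z - d_ v s I) /\
  (b_ m I <= (r - 1) * ((len (Rk R) I1)%:Z - 1) + (len I2 I1)%:Z + d_ v s I /\
   b_ m I >= (r - 1) * (len (addS I2 theta) I1)%:Z + (len I2 I1)%:Z).
Proof.
move=> r I1 I2 theta.
have lI := lattice_I Rbar_finite Rbar_dvr I_ideal I_neq0.
have lR := lattice_Rk Rbar_finite Rbar_dvr.
have lI2 : lattice v I2.
  exact: (lattice_star Rbar_finite Rbar_dvr (lattice_star Rbar_finite Rbar_dvr lI)).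
have I2R : I2 `<=` Rk R by apply: star2_sub_Rk; exact: emb_sub_Rk.
have lth : lattice v theta.
  apply: (lattice_star Rbar_finite Rbar_dvr).
  exact: (lattice_w Rbar_finite Rbar_dvr w_canonical).
have II2 : I1 `<=` I2 := @sub_star2 _ _.
have lA := lattice_add Rbar_dvr lI2 lth; set A := addS I2 theta in lA *.
have thR : theta `<=` Rk R.
  by move=> x /(_ 1 (R_le_w _ (Rk1 R))); rewrite mulr1.
have [sI2 _ _] := lI2; have [sth _ _] := lth.
have I2A : I2 `<=` A by exact: addSl.
have AR : A `<=` Rk R by apply: addS_min => //; exact: Rk_submod.
have upper : (len (star I2) (Rk R) <=
    (cm_type m).-1 * len (Rk R) A + len (Rk R) I2)%N.
  exact: (len_star_upper Rbar_finite Rbar_dvr R_resrat w_canonical).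
rewrite star3 in upper.
have lower := len_star_lower Rbar_finite Rbar_dvr R_resrat w_canonical R_le_w
  w_le_Rbar s_enum I_ideal I_neq0 I_proper.
have r_gt0 := gens_mod1_lt Rbar_finite Rbar_dvr R_resrat w_canonical R_le_w
  w_le_Rbar.
have lenI2 : len (Rk R) I1 = (len (Rk R) I2 + len I2 I1)%N.
  by apply: (lenD Rbar_dvr R_resrat).
have lenA : len (Rk R) I1 = (len (Rk R) A + len A I1)%N.
  by apply: (lenD Rbar_dvr R_resrat) => //; exact: subset_trans II2 I2A.
rewrite /a_ /b_ -/I1 {}/r; move: upper lower r_gt0.
rewrite -/I1 -/I2; move: lenA lenI2.
move: (len (Rk R) A) (len A I1) (len (Rk R) I2) (len I2 I1) (len (Rk R) I1).
move: (len (star I1) (Rk R)) (d_ v s I) (gens_mod1 m w) (cm_type m).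
move=> ls d g [//|r] lRA lAI lRI2 lI2I _ -> El U L _.
by rewrite /= in U; split; split; nia.
Qed.
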